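(* Let $\mathfrak{g}$ be a basic simple $\mathbb{Z}_2\times\mathbb{Z}_2$-graded Lie algebra with a self-centralizing Cartan subalgebra $\mathfrak{t}$, and let $V$ be a finite-dimensional representation of $\mathfrak{g}$ (not necessarily graded). Then $V$ is completely reducible, i.e., there exist irreducible subrepresentations $V_1,\ldots,V_k$ of $V$ such that $V=V_1\oplus\cdots\oplus V_k$.
   Context: Everything is over $\mathbb{C}$ and $\mathfrak{g}$ is finite-dimensional. For $a=(a_1,a_2),b=(b_1,b_2)\in\mathbb{Z}_2\times\mathbb{Z}_2$ put $ab:=a_1b_2-a_2b_1\in\mathbb{Z}_2$. A $\mathbb{Z}_2\times\mathbb{Z}_2$-graded Lie algebra is a $\mathbb{Z}_2\times\mathbb{Z}_2$-graded vector space $\mathfrak{g}=\bigoplus_{a}\mathfrak{g}^a$ with a bilinear bracket such that $[\mathfrak{g}^a,\mathfrak{g}^b]\subseteq\mathfrak{g}^{a+b}$; $[x,y]=-(-1)^{ab}[y,x]$ for $x\in\mathfrak{g}^a,y\in\mathfrak{g}^b$; and $[x,[y,z]]=[[x,y],z]+(-1)^{ab}[y,[x,z]]$ for $x\in\mathfrak{g}^a,y\in\mathfrak{g}^b,z\in\mathfrak{g}$. In particular $\mathfrak{g}^{(0,0)}$ is an ordinary Lie algebra. $\mathfrak{g}$ is simple if it is nonzero and has no graded ideals other than $\{0\}$ and $\mathfrak{g}$. The Killing form is $K(x,y)=\mathrm{tr}(\mathrm{ad}\,x\circ\mathrm{ad}\,y)$, where $\mathrm{ad}(x)(y)=[x,y]$.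 $\mathfrak{g}$ is basic if $K$ is nondegenerate and $\mathfrak{g}^{(0,0)}$ is reductive. A Cartan subalgebra $\mathfrak{t}$ of $\mathfrak{g}$ means a Cartan subalgebra of the reductive Lie algebra $\mathfrak{g}^{(0,0)}$. It is self-centralizing if $\{x\in\mathfrak{g}\mid[x,\mathfrak{t}]=\{0\}\}=\mathfrak{t}$. A representation of $\mathfrak{g}$ on a vector space $V$ is a linear map $\varphi:\mathfrak{g}\to\mathrm{End}(V)$ with $\varphi([x,y])=\varphi(x)\varphi(y)-(-1)^{ab}\varphi(y)\varphi(x)$ for $x\in\mathfrak{g}^a,y\in\mathfrak{g}^b$; $V$ is not assumed graded. A subrepresentation is a $\mathfrak{g}$-invariant linear subspace. *)

(* Defs.v *)
From mathcomp Require Import all_boot all_order all_algebra.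
From mathcomp Require Import complex reals.

Set Implicit Arguments.
Unset Strict Implicit.
Unset Printing Implicit Defensive.

Import GRing.Theory.

Local Open Scope ring_scope.

Notation Z22 := ('Z_2 * 'Z_2)%type.

Definition z22_pair (a b : Z22) : 'Z_2 := a.1 * b.2 - a.2 * b.1.

(* The exponent is the representative of z22_pair a b in {0, 1}. *)
Definition z22_sign (F : fieldType) (a b : Z22) : F := (-1) ^+ z22_pair a b.

(* The bilinear bracket is given in curried form: [x, y] = ad x y.  Being a
   vectType, the carrier is finite-dimensional. *)
Record z22Lie (F : fieldType) := Z22Lie {
  z22_carrier :> vectType F;
  grade : Z22 -> {vspace z22_carrier};
  ad : 'Hom(z22_carrier, 'End(z22_carrier));
  grade_direct : directv (\sum_(a : Z22) grade a)%VS;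
  grade_full : (\sum_(a : Z22) grade a)%VS = fullv;
  bracket_grade : forall a b x y,
    x \in grade a -> y \in grade b -> ad x y \in grade (a + b);
  bracket_antisym : forall a b x y,
    x \in grade a -> y \in grade b -> ad x y = - (z22_sign F a b *: ad y x);
  bracket_jacobi : forall a b x y z,
    x \in grade a -> y \in grade b ->
    ad x (ad y z) = ad (ad x y) z + z22_sign F a b *: ad y (ad x z)
}.

Definition bracket (F : fieldType) (g : z22Lie F) (x y : g) : g := ad g x y.

Notation "[< x , y >]" := (bracket x y) (format "[<  x ,  y  >]").

Section LieTheory.
Variables (F : fieldType) (g : z22Lie F).
Implicit Types (I L N T U V : {vspace g}) (x y z : g).

Definition graded_subspace U : Prop :=
  U = (\sum_(a : Z22) (U :&: grade g a))%VS.

(* For graded I, a left ideal is two-sided by graded antisymmetry. *)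
Definition graded_ideal I : Prop :=
  graded_subspace I /\ forall x y, y \in I -> [< x, y >] \in I.

Definition simple : Prop :=
  (fullv : {vspace g}) <> 0%VS /\
  forall I, graded_ideal I -> I = 0%VS \/ I = fullv.

(* The span of all [u, v] with u in U and v in V. *)
Definition bracketv U V : {vspace g} :=
  <<[seq [< u, v >] | u <- vbasis U, v <- vbasis V]>>%VS.

(* The notions below are applied to subspaces of the degree (0, 0) component,
   where the bracket is an ordinary Lie bracket. *)

Definition subalgebra U : Prop :=
  forall x y, x \in U -> y \in U -> [< x, y >] \in U.

Definition ideal_of L I : Prop :=
  (I <= L)%VS /\ forall x y, x \in L -> y \in I -> [< x, y >] \in I.

Definition derived_series U (n : nat) : {vspace g} :=
  iter n (fun W => bracketv W W) U.

Definition solvable U : Prop := exists n, derived_series U n = 0%VS.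

Definition lower_central_series U (n : nat) : {vspace g} :=
  iter n (bracketv U) U.

Definition nilpotent U : Prop := exists n, lower_central_series U n = 0%VS.

Definition is_radical L N : Prop :=
  [/\ ideal_of L N, solvable N &
      forall I, ideal_of L I -> solvable I -> (I <= N)%VS].

Definition is_center L N : Prop :=
  forall x, x \in N <-> x \in L /\ forall y, y \in L -> [< x, y >] = 0.

(* The radical of L is its center. *)
Definition reductive L : Prop := exists2 N, is_radical L N & is_center L N.

Definition self_normalizing L T : Prop :=
  forall x, x \in L -> (forall y, y \in T -> [< x, y >] \in T) -> x \in T.

Definition cartan_subalgebra_of L T : Prop :=
  [/\ (T <= L)%VS, subalgebra T, nilpotent T & self_normalizing L T].

Definition cartan_subalgebra T : Prop :=
  cartan_subalgebra_of (grade g (0, 0)) T.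

(* The centralizer of T is taken in all of g. *)
Definition self_centralizing T : Prop :=
  forall x, (forall y, y \in T -> [< x, y >] = 0) <-> x \in T.

Definition lfun_trace (W : vectType F) (f : 'End(W)) : F :=
  \tr (passmx.mxof (vbasis {:W}) (vbasis {:W}) f).

Definition killing x y : F := lfun_trace (ad g x \o ad g y)%VF.

Definition killing_nondegenerate : Prop :=
  forall x, (forall y, killing x y = 0) -> x = 0.

Definition basic : Prop :=
  killing_nondegenerate /\ reductive (grade g (0, 0)).

Section Representations.
Variable V : vectType F.

Definition is_representation (phi : 'Hom(g, 'End(V))) : Prop :=
  forall a b x y, x \in grade g a -> y \in grade g b ->
    phi [< x, y >] =
      (phi x \o phi y)%VF - z22_sign F a b *: (phi y \o phi x)%VF.

Definition subrepresentation (phi : 'Hom(g, 'End(V))) (U : {vspace V}) : Prop :=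
  forall x v, v \in U -> phi x v \in U.

Definition irreducible_subrep (phi : 'Hom(g, 'End(V))) (W : {vspace V}) : Prop :=
  [/\ subrepresentation phi W, W <> 0%VS &
      forall U : {vspace V}, (U <= W)%VS -> subrepresentation phi U ->
        U = 0%VS \/ U = W].

Definition completely_reducible (phi : 'Hom(g, 'End(V))) : Prop :=
  exists (k : nat) (W : 'I_k -> {vspace V}),
    [/\ forall i, irreducible_subrep phi (W i),
        directv (\sum_(i < k) W i)%VS &
        (\sum_(i < k) W i)%VS = fullv].

End Representations.

End LieTheory.

Arguments simple {F} g.
Arguments basic {F} g.

(* Main.v *)
Require Import Defs.
From HB Require Import structures.
From mathcomp Require Import all_boot all_order all_algebra.
From mathcomp Require Import complex reals boolp.
From mathcomp Require Import ring.

Set Implicit Arguments.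
Unset Strict Implicit.
Unset Printing Implicit Defensive.

Import Order.TTheory GRing.Theory Num.Theory passmx.
Local Open Scope ring_scope.

(** A Z_2 x Z_2-graded Lie algebra g is an ordinary Lie algebra up to signs, and
    the theorem is Weyl's complete reducibility theorem up to the same signs.

    Removing the signs.  The function c(a, b) = (-1)^(a_2 b_1) is
    bimultiplicative, and c(b, a) = (-1)^(ab) c(a, b).  So on g the rule
    [x, y]' = c(a, b) [x, y], for x and y of degrees a and b, defines an ordinary
    Lie bracket ([discolored]).  The 2 x 2 matrices
    gamma_a = diag(1, -1)^(a_1) (0 1; 1 0)^(a_2) satisfy
    gamma_a gamma_b = c(a, b) gamma_(a+b), so sending x of degree a to
    gamma_a ⊗ phi(x) is a representation of this Lie algebra on C^2 ⊗ V
    ([discolored_rhoP]).  On each pair of graded components the two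
    Killing forms agree up to sign, so the new one is nondegenerate as well
    ([discolored_nondegenerate]).  If U is a
    subrepresentation of V, Weyl's theorem provides a projector onto C^2 ⊗ U
    that commutes with the new action; the mean of its two diagonal blocks is a
    projector of V onto U that commutes with phi, and its kernel is a complement
    of U ([subrep_complement]).  Splitting off subrepresentations repeatedly
    decomposes V ([subrep_decomposition]).

    Weyl's theorem.  Let L be a Lie algebra with nondegenerate Killing form K, and
    rho a representation.  An equivariant projector exists as soon as every
    1-cocycle of L is a coboundary ([whitehead_first]).  If some Casimir operator
    of rho were invertible it would turn any cocycle into a coboundary
    ([mul_casimir]); in general its Fitting projector splits off the part of the
    representation where it is invertible, and one goes on with the rest.  This
    stops because a nonzero rho has a Casimir operator that is not nilpotent
    ([detecting_casimir]): write tr(rho(x) rho(y)) = K(Theta x, y), let T be a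
    polynomial in Theta that has the complex conjugate eigenvalues, and let (e_i),
    (f_i) be K-dual bases.  The trace of the sum of the rho(T e_i) rho(f_i) is
    tr(Theta T), the sum of the squared moduli of the eigenvalues of Theta.  If it
    vanishes, Theta is nilpotent, and since it commutes with ad, K(Theta x, y) is
    the trace of a nilpotent map.  So the trace form of rho is zero, and then rho
    is zero by Cartan's criterion ([isotropic_trivial]).

    Cartan's criterion.  If the trace form of rho is zero, the same conjugation
    trick, applied to rho(x), shows that rho(x) is nilpotent
    ([isotropic_nilpotent]).  So the elements of the K-orthogonal of ker rho are
    ad-nilpotent, K vanishes on this ideal, the ideal is abelian, and therefore it
    is zero ([abelian_ideal_eq0]). *)

(** * Polynomials and matrices over an algebraically closed field *)

Lemma Bezout_poly (F : fieldType) (p q : {poly F}) :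
  coprimep p q -> exists u v, u * p + v * q = 1.
Proof.
case/Bezout_coprimepP=> [[u v] /=]; rewrite -size_poly_eq1.
case/size_poly1P=> c c_neq0 uv_c; exists (c^-1 *: u), (c^-1 *: v).
by rewrite -!scalerAl -scalerDr uv_c -mul_polyC -polyCM mulVf.
Qed.

(** Chinese remaindering for powers of distinct linear factors, one point at a
    time. *)
Lemma poly_interpolation (F : fieldType) (s : seq F) (c : F -> F) N :
  exists q, {in s, forall a, ('X - a%:P) ^+ N %| q - (c a)%:P}.
Proof.
elim: s => [|b s [q qP]]; first by exists 0.
have [b_s | bNs] := boolP (b \in s).
  by exists q => a; rewrite inE => /predU1P[->|]; apply: qP.
pose D := \prod_(a <- s) ('X - a%:P) ^+ N.
have cD : coprimep D (('X - b%:P) ^+ N).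
  rewrite /D coprimep_sym (@big_morph _ _ _ true andb); last 2 first.
  - by move=> ? ?; rewrite coprimepMr.
  - exact: coprimep1.
  rewrite big_all; apply/allP => a a_s.
  rewrite coprimep_expl // coprimep_expr // coprimep_XsubC root_XsubC.
  by apply: contraNneq bNs => <-.
have [u [v uv1]] := Bezout_poly cD.
exists (q + u * D * ((c b)%:P - q)) => a; rewrite inE => /predU1P[->|a_s].
  rewrite (_ : _ - _ = v * (q - (c b)%:P) * ('X - b%:P) ^+ N) ?dvdp_mulIr //.
  have -> : u * D = 1 - v * ('X - b%:P) ^+ N by rewrite -uv1 addrK.
  by ring.
rewrite addrAC dvdp_add ?qP // dvdp_mulr // dvdp_mull //.
by rewrite /D (big_rem a) //= dvdp_mulIl.
Qed.

Section Triangular.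
Variables (F : fieldType) (n : nat).
Implicit Types T U : 'M[F]_n.

Lemma mul_trig T U : is_trig_mx T -> is_trig_mx U ->
  is_trig_mx (T *m U) /\ forall i, (T *m U) i i = T i i * U i i.
Proof.
move=> /is_trig_mxP tT /is_trig_mxP tU; split=> [|i].
  apply/is_trig_mxP => i j lt_ij; rewrite mxE big1 // => k _.
  have [lt_ik | le_ki] := ltnP i k; first by rewrite tT ?mul0r.
  by rewrite tU ?mulr0 // (leq_ltn_trans le_ki).
rewrite mxE (bigD1 i) //= big1 ?addr0 // => k neq_ki.
have [lt_ik | lt_ki | eq_ik] := ltngtP i k; first by rewrite tT ?mul0r.
  by rewrite tU ?mulr0.
by rewrite (val_inj eq_ik) eqxx in neq_ki.
Qed.

End Triangular.

Lemma horner_trig (F : fieldType) n (T : 'M[F]_n.+1) p : is_trig_mx T ->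
  is_trig_mx (horner_mx T p) /\ forall i, horner_mx T p i i = p.[T i i].
Proof.
move=> tT; elim/poly_ind: p => [|p c [tp dp]].
  by rewrite rmorph0 mx0_is_trig; split=> // i; rewrite horner0 mxE.
rewrite rmorphD rmorphM /= horner_mx_X horner_mx_C -mulmxE.
have [tpT dpT] := mul_trig tp tT.
split=> [|i]; last by rewrite mxE dpT dp !mxE eqxx mulr1n hornerMXaddC.
have /is_trig_mxP tpT' := tpT; have /is_trig_mxP tc := scalar_mx_is_trig n.+1 c.
by apply/is_trig_mxP => i j lt_ij; rewrite mxE tpT' ?tc ?addr0.
Qed.

Lemma nilpotent_of_nil_diag (F : fieldType) n (T : 'M[F]_n) :
  is_trig_mx T -> (forall i, T i i = 0) -> T ^+ n = 0.
Proof.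
case: n T => [|n] T tT dT; first by apply/matrixP=> -[].
have := Cayley_Hamilton T; rewrite char_poly_trig //.
under eq_bigr do rewrite dT subr0.
by rewrite prodr_const card_ord rmorphXn /= horner_mx_X.
Qed.

Lemma trmx_exp (F : comPzRingType) n (A : 'M[F]_n) k : (A ^+ k)^T = A^T ^+ k.
Proof.
elim: k => [|k IHk]; first exact: trmx1.
by rewrite exprS exprSr -!mulmxE trmx_mul IHk.
Qed.

Section Closed.
Variable C : numClosedFieldType.

Lemma trigonalization n (A : 'M[C]_n) :
  exists2 P : 'M_n, P \in unitmx & is_trig_mx (P *m A *m invmx P).
Proof.
case: n A => [|n] A.
  by exists 1%:M; rewrite ?unitmx1 // flatmx0 mx0_is_trig.
have [P /unitarymx_unit uP tP] := Schur A (ltn0Sn n).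
by exists P => //; rewrite -conjumx.
Qed.

Lemma trace_nilpotent n (A : 'M[C]_n) k : A ^+ k = 0 -> \tr A = 0.
Proof.
case: n A => [|n] A Ak; first by rewrite flatmx0 raddf0.
have [P uP tP] := trigonalization A.
have [_ dT] := horner_trig ('X^k) tP.
have T0 : horner_mx (P *m A *m invmx P) 'X^k = 0.
  by rewrite horner_mx_uconj // rmorphXn /= horner_mx_X Ak mulmx0 mul0mx.
have -> : \tr A = \tr (P *m A *m invmx P) by rewrite mxtrace_mulC mulKmx.
rewrite /mxtrace big1 // => i _; apply/eqP; have := dT i.
by rewrite T0 hornerXn mxE => /esym/eqP; rewrite expf_eq0 => /andP[_].
Qed.

Lemma annihilator_pow n (A : 'M[C]_n) k N m (Z : 'M_(n, m)) :
  (k <= N)%N -> A ^+ k *m Z = 0 -> A ^+ N *m Z = 0.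
Proof. by move=> /subnK <- AkZ; rewrite exprD -mulmxE -mulmxA AkZ mulmx0. Qed.

(** [B] is a polynomial in [A] with value [a^*] at each eigenvalue [a] of [A], so
    that the trace of [A *m B] is the sum of the squared moduli of the eigenvalues
    of [A], and vanishes only if all of them do.  At the points of [s] it takes the
    value [a^*] to order [N]; this controls [B] on vectors that are only known to
    be killed by a power of [A - a%:M], where [a] may fail to be an eigenvalue. *)
Lemma conjugate_part n (A : 'M[C]_n) (s : seq C) N :
  exists B : 'M[C]_n,
    [/\ forall D, A *m D = D *m A -> B *m D = D *m B,
        forall a m (Z : 'M_(n, m)), a \in s ->
          (A - a%:M) ^+ N *m Z = 0 -> B *m Z = a^* *: Z &
        \tr (A *m B) = 0 -> A ^+ n = 0].
Proof.
case: n A => [|n] A.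
  by exists 0; split=> *; apply/matrixP=> -[].
have [P uP tP] := trigonalization A; set T := P *m A *m invmx P in tP.
pose s' := s ++ [seq T i i | i : 'I_n.+1].
have [q qP] := poly_interpolation s' Num.conj N.+1.
exists (horner_mx A q); split.
- by move=> D AD; apply: comm_horner_mx.
- move=> a m Z a_s AZ; have /qP/dvdpP[r q_r] : a \in s' by rewrite mem_cat a_s.
  have -> : q = (a^*)%:P + r * ('X - a%:P) ^+ N.+1 by rewrite -q_r addrC subrK.
  rewrite rmorphD rmorphM rmorphXn rmorphB /= horner_mx_X !horner_mx_C.
  rewrite mulmxDl -!mulmxE -mulmxA (annihilator_pow (leqnSn N) AZ) mulmx0 addr0.
  by rewrite mul_scalar_mx.
have dT i : (T *m horner_mx T q) i i = `|T i i| ^+ 2.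
  have [tq dq] := horner_trig q tP.
  rewrite (mul_trig tP tq).2 dq normCK; congr (_ * _).
  have /qP/dvdpP[r q_r] : T i i \in s'.
    by rewrite mem_cat; apply/orP; right; apply/mapP; exists i; rewrite ?mem_enum.
  apply/eqP; rewrite -subr_eq0 -[_^*](hornerC _ (T i i)) -hornerN -hornerD q_r.
  by rewrite hornerM horner_exp hornerXsubC subrr expr0n mulr0.
have trT : \tr (A *m horner_mx A q) = \sum_i `|T i i| ^+ 2.
  rewrite -(eq_bigr _ (fun i _ => dT i)) -/(mxtrace _) /T horner_mx_uconj //.
  by rewrite -!mulmxA mulKmx // [in RHS]mxtrace_mulC -!mulmxA mulVmx // mulmx1.
rewrite trT => /eqP; rewrite psumr_eq0 => [/allP T0|i _]; last exact: exprn_ge0.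
have /(nilpotent_of_nil_diag tP) : forall i, T i i = 0.
  move=> i; have /implyP := T0 i (mem_index_enum i).
  by rewrite expf_eq0 normr_eq0 /= => /(_ isT)/eqP.
have -> : A = invmx P *m T *m P by rewrite /T !mulmxA mulVmx // mul1mx mulmxKV.
move=> Tn; have := horner_mx_uconjC ('X^(n.+1)) T uP.
by rewrite !rmorphXn /= !horner_mx_X Tn mulmx0 mul0mx.
Qed.

(** Fitting decomposition: [A *m H] is the projector onto the largest subspace on
    which [A] is invertible.  If the characteristic polynomial is [r * 'X^k] with
    [r] prime to ['X], it comes from a Bezout relation between ['X^(k.+1)] and
    [r]; the exponent [k.+1] makes it a multiple of [A]. *)
Lemma fitting n (A : 'M[C]_n) :
  exists H : 'M[C]_n,
    [/\ forall D, A *m D = D *m A -> H *m D = D *m H,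
        (A *m H) *m (A *m H) = A *m H &
        A *m H = 0 -> exists k, A ^+ k = 0].
Proof.
case: n A => [|n] A.
  exists 0; split=> [*|*|_]; try by apply/matrixP=> -[].
  by exists 0; apply/matrixP=> -[].
have chi0 : char_poly A != 0 by rewrite monic_neq0 ?char_poly_monic.
have [k [r]] := multiplicity_XsubC (char_poly A) 0.
rewrite chi0 subr0 => r0 chiE.
have : coprimep ('X^(k.+1)) r.
  by rewrite coprimep_expl // coprimep_sym -['X]subr0 coprimep_XsubC.
case/Bezout_poly=> u [v uv1].
have rA : horner_mx A ('X^k * r) = 0 by rewrite mulrC -chiE Cayley_Hamilton.
pose h := u * 'X^k; exists (horner_mx A h).
have eE : A *m horner_mx A h = horner_mx A (h * 'X).
  by rewrite [RHS]rmorphM /= horner_mx_X; apply/esym/comm_horner_mx.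
have e1E : 1 - horner_mx A (h * 'X) = horner_mx A (v * r).
  rewrite -(rmorph1 (horner_mx A)) -uv1 -mulrA -exprSr rmorphD.
  by rewrite addrAC subrr add0r.
split; first by move=> D AD; apply: comm_horner_mx.
- rewrite eE; apply/eqP; rewrite -subr_eq0 -oppr_eq0 opprB; apply/eqP.
  rewrite -{1}[horner_mx A _]mulr1 mulmxE -mulrBr e1E -rmorphM /=.
  rewrite (_ : h * _ * _ = u * 'X * v * ('X^k * r)); last by rewrite /h; ring.
  by rewrite [LHS]rmorphM /= rA mulr0.
rewrite eE => e0; exists k; move: e1E; rewrite e0 subr0 => one_vr.
rewrite -[A ^+ k]mulr1 one_vr -{1}(horner_mx_X A) -rmorphXn -rmorphM mulrCA.
by rewrite [LHS]rmorphM /= rA mulr0.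
Qed.

(** The generalized eigenspaces span the whole space.  Kernels of matrices are
    spaces of row vectors, whence the transpositions in the proof. *)
Lemma generalized_eigen_decomposition n (A : 'M[C]_n) :
  exists m (mu : 'I_m -> C) (E : 'I_m -> 'M[C]_n),
    1%:M = \sum_i E i /\ forall i, (A - (mu i)%:M) ^+ n *m E i = 0.
Proof.
case: n A => [|n] A.
  by exists 0, (fun=> 0), (fun=> 0); split=> [|i]; apply/matrixP=> -[].
have [rs chiE] := closed_field_poly_normal (char_poly A^T).
rewrite (monicP (char_poly_monic _)) scale1r in chiE.
pose s := undup rs; pose mu (i : 'I_(size s)) := s`_i.
pose p i : {poly C} := ('X - (mu i)%:P) ^+ n.+1.
have chi_p : char_poly A^T %| \prod_i p i.
  rewrite /p -(big_mkord xpredT (fun i => ('X - (s`_i)%:P) ^+ n.+1)).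
  rewrite -(big_nth 0 xpredT (fun a => ('X - a%:P) ^+ n.+1)).
  rewrite chiE -prodr_undup_exp_count big_seq [X in _ %| X]big_seq.
  elim/big_ind2: _ => [|? ? ? ?|a]; first exact: dvdpp.
    exact: dvdp_mul.
  rewrite mem_undup => a_rs; apply: dvdp_exp2l.
  have := size_char_poly A^T; rewrite chiE size_prod_XsubC; case=> <-.
  exact: count_size.
have cop : {in xpredT &, forall i j, j != i -> coprimep (p i) (p j)}.
  move=> i j _ _ neq_ji; apply/coprimep_expl/coprimep_expr.
  rewrite coprimep_XsubC2 // subr_eq0; apply: contraNneq neq_ji => /eqP.
  by rewrite nth_uniq ?undup_uniq.
have := kermxpoly_prod A^T cop.
have /kermxpoly_min/eqmx_sym full := dvdp_trans (mxminpoly_dvd_char _) chi_p.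
move=> /(eqmx_trans full)/eqmxP/andP[/sub_sumsmxP[u uE] _].
exists (size s), mu, (fun i => (u i *m kermxpoly A^T (p i))^T).
split=> [|i]; first by rewrite -raddf_sum -uE; apply/esym/trmx1.
apply: trmx_inj; rewrite trmx_mul trmxK trmx0 -mulmxA.
have -> : ((A - (mu i)%:M) ^+ n.+1)^T = horner_mx A^T (p i).
  rewrite rmorphXn /= rmorphB /= horner_mx_X horner_mx_C.
  by rewrite trmx_exp [(_ - _)^T]linearB /= tr_scalar_mx.
by rewrite (sub_kermxP (submx_refl _)) mulmx0.
Qed.

End Closed.

(** * Lie algebras in coordinates and their trace forms *)

(** A Lie algebra on the space of column vectors, given by its adjoint map: the
    bracket of [x] and [y] is [ad x *m y], so that the algebra acts on itself and
    on its representations by matrices. *)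
Record lieAlgebra (F : fieldType) (d : nat) := LieAlgebra {
  lie_ad :> {linear 'cV[F]_d -> 'M[F]_d};
  lie_antisym : forall x y, lie_ad x *m y = - (lie_ad y *m x);
  lie_jacobi : forall x y,
    lie_ad (lie_ad x *m y) = lie_ad x *m lie_ad y - lie_ad y *m lie_ad x
}.

Definition lie_rep (F : fieldType) d (L : lieAlgebra F d) n
    (rho : {linear 'cV[F]_d -> 'M[F]_n}) :=
  forall x y, rho (L x *m y) = rho x *m rho y - rho y *m rho x.

Definition trace_form (F : fieldType) d n
    (rho : {linear 'cV[F]_d -> 'M[F]_n}) (x y : 'cV[F]_d) : F :=
  \tr (rho x *m rho y).

Definition nondegenerate_killing (F : fieldType) d (L : lieAlgebra F d) :=
  forall x, (forall y, trace_form L x y = 0) -> x = 0.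

(** Equivalently, [g] is a derivation of [L] with values in the matrices on which
    [rho] acts by left multiplication. *)
Definition lie_cocycle (F : fieldType) d (L : lieAlgebra F d) n m
    (rho : {linear 'cV[F]_d -> 'M[F]_n}) (g : {linear 'cV[F]_d -> 'M[F]_(n, m)}) :=
  forall x y, g (L x *m y) = rho x *m g y - rho y *m g x.

Section TraceForm.
Variables (F : fieldType) (d n : nat) (rho : {linear 'cV[F]_d -> 'M[F]_n}).
Local Notation B := (trace_form rho).
Implicit Types x y z : 'cV[F]_d.

Lemma trace_formC x y : B x y = B y x.
Proof. exact: mxtrace_mulC. Qed.

Lemma trace_formDl x x' y : B (x + x') y = B x y + B x' y.
Proof. by rewrite /trace_form linearD mulmxDl raddfD. Qed.

Lemma trace_formZl a x y : B (a *: x) y = a * B x y.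
Proof. by rewrite /trace_form linearZ -scalemxAl mxtraceZ. Qed.

Lemma trace_formDr x y y' : B x (y + y') = B x y + B x y'.
Proof. by rewrite trace_formC trace_formDl !(trace_formC x). Qed.

Lemma trace_formZr a x y : B x (a *: y) = a * B x y.
Proof. by rewrite trace_formC trace_formZl (trace_formC x). Qed.

Lemma trace_formNl x y : B (- x) y = - B x y.
Proof. by rewrite -scaleN1r trace_formZl mulN1r. Qed.

Lemma trace_form0r x : B x 0 = 0.
Proof. by rewrite /trace_form linear0 mulmx0 mxtrace0. Qed.

Lemma trace_form_sumr (I : finType) x (y : I -> 'cV_d) :
  B x (\sum_i y i) = \sum_i B x (y i).
Proof.
by elim/big_rec2: _ => [|i a b _ <-]; rewrite ?trace_form0r ?trace_formDr.
Qed.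

Lemma trace_form_suml (I : finType) (x : I -> 'cV_d) y :
  B (\sum_i x i) y = \sum_i B (x i) y.
Proof.
rewrite trace_formC trace_form_sumr; apply: eq_bigr => i _.
exact: trace_formC.
Qed.

Definition gram : 'M[F]_d := \matrix_(i, j) B (delta_mx i 0) (delta_mx j 0).

Lemma tr_gram : gram^T = gram.
Proof. by apply/matrixP=> i j; rewrite !mxE trace_formC. Qed.

Lemma cV_sum_delta (x : 'cV[F]_d) : x = \sum_i x i 0 *: delta_mx i 0.
Proof.
rewrite [LHS]matrix_sum_delta; apply: eq_bigr => i _.
by rewrite big_ord1.
Qed.

Lemma trace_form_gram x y : B x y = (x^T *m gram *m y) 0 0.
Proof.
rewrite -mulmxA {1}[x]cV_sum_delta {1}[y]cV_sum_delta trace_form_suml mxE.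
apply: eq_bigr => i _; rewrite !mxE trace_formZl trace_form_sumr; congr (_ * _).
by apply: eq_bigr => j _; rewrite trace_formZr mxE mulrC.
Qed.

(** Both sides are the trace of [rho x *m rho y *m rho z] minus that of
    [rho y *m rho x *m rho z], by cyclicity. *)
Lemma trace_form_inv (L : lieAlgebra F d) : lie_rep L rho ->
  forall x y z, B (L x *m y) z = B x (L y *m z).
Proof.
move=> rhoP x y z; rewrite /trace_form !rhoP mulmxBl mulmxBr !raddfB /=.
by rewrite -!mulmxA; congr (_ - _); rewrite mxtrace_mulC -mulmxA.
Qed.

End TraceForm.

Lemma mulmx_cV_eq0 (F : fieldType) m n (A : 'M[F]_(m, n)) :
  (forall x : 'cV_n, A *m x = 0) -> A = 0.
Proof.
move=> A0; apply/matrixP=> i j; rewrite [RHS]mxE.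
by have /matrixP/(_ i 0) := A0 (delta_mx j 0); rewrite -colE !mxE.
Qed.

Section Semisimple.
Variables (C : numClosedFieldType) (d : nat) (L : lieAlgebra C d).
Hypothesis K_nondeg : nondegenerate_killing L.
Local Notation K := (trace_form L).
Implicit Types x y z : 'cV[C]_d.

Lemma ad_rep : lie_rep L L. Proof. exact: lie_jacobi. Qed.

Lemma killing_inv x y z : K (L x *m y) z = K x (L y *m z).
Proof. exact: trace_form_inv ad_rep x y z. Qed.

Local Notation G := (gram L).

Lemma gram_unit : G \in unitmx.
Proof.
rewrite -row_free_unit -kermx_eq0; apply/rowV0P=> v /sub_kermxP vG.
apply: trmx_inj; rewrite trmx0; apply: K_nondeg => y.
by rewrite trace_form_gram trmxK vG mul0mx mxE.
Qed.

Definition dual i : 'cV[C]_d := col i (invmx G).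

Lemma K_dual i x : K (dual i) x = x i 0.
Proof.
rewrite trace_form_gram /dual tr_col trmx_inv tr_gram -row_mul.
rewrite mulVmx ?gram_unit //.
by rewrite -row_mul mul1mx mxE.
Qed.

Lemma K_inj x y : (forall z, K x z = K y z) -> x = y.
Proof.
move=> eqxy; apply/eqP; rewrite -subr_eq0; apply/eqP/K_nondeg => z.
by rewrite trace_formDl trace_formNl eqxy subrr.
Qed.

Lemma dual_expand x : x = \sum_i K (delta_mx i 0) x *: dual i.
Proof.
apply: K_inj => z; rewrite trace_form_suml trace_formC [z in LHS]cV_sum_delta.
rewrite trace_form_suml; apply: eq_bigr => i _.
by rewrite trace_formZl [RHS]trace_formZl K_dual mulrC.
Qed.

Lemma killing_riesz (l : 'cV[C]_d -> C) :
  scalar l -> exists r, forall x, l x = K r x.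
Proof.
move=> lP; pose l' := GRing.isLinear.Build _ _ _ _ l lP.
pose f : {linear 'cV[C]_d -> C | *%R} := HB.pack l l'.
exists (\sum_i f (delta_mx i 0) *: dual i) => x.
rewrite -[l]/(f : _ -> _) {1}[x]cV_sum_delta linear_sum trace_form_suml.
by apply: eq_bigr => i _; rewrite linearZ trace_formZl K_dual mulrC.
Qed.

(** This says that [L] is spanned by brackets.  The vector [r] that represents [l]
    is orthogonal to all brackets, hence central by invariance, hence in the
    radical of [K]. *)
Lemma scalar_vanishing_on_brackets (l : 'cV[C]_d -> C) : scalar l ->
  (forall x y, l (L x *m y) = 0) -> forall x, l x = 0.
Proof.
move=> /killing_riesz[r lE] l0.
suff r0 : r = 0 by move=> x; rewrite lE r0 trace_formC trace_form0r.
apply: K_nondeg => y; rewrite /trace_form.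
suff -> : L r = 0 by rewrite mul0mx mxtrace0.
apply: mulmx_cV_eq0 => x; apply: K_nondeg => z.
by rewrite killing_inv -lE l0.
Qed.

Lemma entry_scalar p q (f : {linear 'cV[C]_d -> 'M[C]_(p, q)}) i j :
  scalar (fun x => f x i j).
Proof. by move=> a x y /=; rewrite linearP !mxE. Qed.

Lemma linear_vanishing_on_brackets p q (f : {linear 'cV[C]_d -> 'M[C]_(p, q)}) :
  (forall x y, f (L x *m y) = 0) -> forall x, f x = 0.
Proof.
move=> f0 x; apply/matrixP=> i j; rewrite [RHS]mxE.
apply: (scalar_vanishing_on_brackets (entry_scalar f i j)) => {}x y.
by rewrite f0 mxE.
Qed.

(** For [x] in an abelian ideal and any [y], the map [L x *m L y] has square zero,
    so [x] is in the radical of [K].  The ideal is given by its membership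
    predicate. *)
Lemma abelian_ideal_eq0 (P : 'cV[C]_d -> Prop) :
    (forall x y, P x -> P (L y *m x)) ->
    (forall x y, P x -> P y -> L x *m y = 0) ->
  forall x, P x -> x = 0.
Proof.
move=> PI abP x Px; apply: K_nondeg => y.
apply: (@trace_nilpotent _ _ _ 2); rewrite expr2 -mulmxE.
apply: mulmx_cV_eq0 => z; rewrite -!mulmxA [L x *m (L y *m z)]lie_antisym.
by rewrite !mulmxN (abP x) ?oppr0 //; exact: (PI _ _ (PI _ _ Px)).
Qed.

(** * Representations with zero trace form *)

Section Representation.
Variables (n : nat) (rho : {linear 'cV[C]_d -> 'M[C]_n}).
Hypothesis rhoP : lie_rep L rho.

(** An element of weight [nu] for [L x] maps the generalized eigenspace of [rho x]
    for [a] to that for [a + nu].  Moving one factor past [rho y] lowers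
    the exponent of [Z] or that of [y]. *)
Lemma weight_shift x a nu y m (Z : 'M_(n, m)) k l :
  (L x - nu%:M) ^+ k *m y = 0 -> (rho x - a%:M) ^+ l *m Z = 0 ->
  (rho x - (a + nu)%:M) ^+ (k + l) *m (rho y *m Z) = 0.
Proof.
elim: k l m y Z => [|k IHk] l m y Z.
  by rewrite expr0 mul1mx => -> _; rewrite linear0 mul0mx mulmx0.
elim: l m Z y => [|l IHl] m Z y yk Zl.
  by move: Zl; rewrite expr0 mul1mx => ->; rewrite !mulmx0.
have step : (rho x - (a + nu)%:M) *m (rho y *m Z) =
    rho y *m ((rho x - a%:M) *m Z) + rho ((L x - nu%:M) *m y) *m Z.
  have -> : rho ((L x - nu%:M) *m y)
      = rho x *m rho y - rho y *m rho x - nu *: rho y.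
    by rewrite mulmxBl mul_scalar_mx -rhoP -linearZ -linearB.
  rewrite !mulmxBl mulmxBr !mul_scalar_mx -!scalemxAl -scalemxAr scalerDl !mulmxA.
  by rewrite [RHS]addrACA [X in _ = X + _]addrC subrK opprD.
rewrite addSn exprSr -mulmxE -mulmxA step mulmxDr.
rewrite {1}addnS -{1}addSn IHl ?add0r; last 2 first.
- exact: yk.
- by rewrite mulmxA mulmxE -exprSr.
rewrite IHk ?addr0 //.
by rewrite mulmxA mulmxE -exprSr.
Qed.

(** The conjugate part [Y] of [rho x] normalizes [rho L]: it multiplies an element
    of weight [nu] for [L x] by [nu^*], because [Y] acts by [(a + nu)^*] after it
    and by [a^*] before it.  As the trace form is zero, the functional
    [fun y => \tr (rho y *m Y)] then vanishes on brackets, hence everywhere, and in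
    particular at [x]. *)
Lemma isotropic_nilpotent x :
  (forall y z, trace_form rho y z = 0) -> rho x ^+ n = 0.
Proof.
move=> B0.
have [m1 [mu [E [E1 EX]]]] := generalized_eigen_decomposition (rho x).
have [m2 [nu [E' [E1' EX']]]] := generalized_eigen_decomposition (L x).
(* The points at which the conjugate part gets evaluated. *)
pose s := [seq mu i | i : 'I_m1]
  ++ [seq mu i + nu j | i <- enum 'I_m1, j <- enum 'I_m2].
have [Y [_ Yeig Ynil]] := conjugate_part (rho x) s (d + n).
apply: Ynil.
have Y_normalizes y : exists y', Y *m rho y - rho y *m Y = rho y'.
  exists (\sum_j (nu j)^* *: (E' j *m y)).
  rewrite -{1 2}[y]mul1mx E1' mulmx_suml !linear_sum /= mulmx_suml -sumrB.
  apply: eq_bigr => j _.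
  rewrite linearZ /= -[LHS]mulmx1 -[RHS]mulmx1 E1 !mulmx_sumr.
  apply: eq_bigr => i _.
  set z := E' j *m y; have zk : (L x - (nu j)%:M) ^+ d *m z = 0.
    by rewrite mulmxA EX' mul0mx.
  rewrite mulmxBl -!mulmxA (Yeig (mu i) _ (E i)); last 2 first.
  - by rewrite mem_cat; apply/orP; left; apply/mapP; exists i; rewrite ?mem_enum.
  - exact: annihilator_pow (leq_addl d n) (EX i).
  rewrite (Yeig (mu i + nu j) _ (rho z *m E i)); last 2 first.
  - rewrite mem_cat; apply/orP; right; apply/allpairsP; exists (i, j).
    by rewrite !mem_enum.
  - exact: weight_shift zk (EX i).
  by rewrite rmorphD scalerDl -scalemxAr -scalemxAl addrAC subrr add0r.
have trY_scalar : scalar (fun y => \tr (rho y *m Y)).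
  by move=> a u v /=; rewrite linearP mulmxDl -scalemxAl linearP.
apply: (scalar_vanishing_on_brackets trY_scalar) => u v; rewrite rhoP.
have [v' Yv] := Y_normalizes v.
rewrite mulmxBl raddfB /= -[rho v *m _ *m _]mulmxA [X in _ - X]mxtrace_mulC.
by rewrite -!mulmxA -raddfB -mulmxBr -opprB Yv mulmxN raddfN /= [\tr _]B0 oppr0.
Qed.

(** A form of Cartan's criterion: every element of the orthogonal of the kernel of
    [rho] is ad-nilpotent, which makes this ideal isotropic, hence abelian, hence
    zero; and [K] represents each matrix entry of [rho] by an element of it. *)
Lemma isotropic_trivial :
  (forall y z, trace_form rho y z = 0) -> forall x, rho x = 0.
Proof.
move=> B0.
pose perp x := forall y, rho y = 0 -> K x y = 0.
suff perp0 r : perp r -> r = 0.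
  move=> x; apply/matrixP=> i j; rewrite [RHS]mxE.
  have [r rE] := killing_riesz (entry_scalar rho i j).
  have r0 : r = 0 by apply: perp0 => y y0; rewrite -rE y0 mxE.
  by rewrite rE r0 (trace_formC L) (trace_form0r L).
have ker_ideal x y : rho x = 0 -> rho (L y *m x) = 0.
  by move=> x0; rewrite rhoP x0 mulmx0 mul0mx subrr.
have perp_ideal x y : perp x -> perp (L y *m x).
  move=> Px z z0; rewrite lie_antisym trace_formNl killing_inv Px ?oppr0 //.
  exact: ker_ideal.
have disjoint x : rho x = 0 /\ perp x -> x = 0.
  apply: (abelian_ideal_eq0 (P := fun x => rho x = 0 /\ perp x)) => {}x y.
    by move=> [x0 Px]; split; [apply: ker_ideal | apply: perp_ideal].
  move=> [_ Px] [y0 _]; apply: K_nondeg => z; rewrite killing_inv Px //.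
  by rewrite lie_antisym linearN ker_ideal ?oppr0.
have perp_ker x y : perp x -> rho y = 0 -> L x *m y = 0.
  move=> Px y0; apply: disjoint; split; first exact: ker_ideal.
  rewrite lie_antisym -mulmxN; apply: perp_ideal => z z0.
  by rewrite trace_formNl Px ?oppr0.
(* The power (ad rho(x))^(2n) is zero, so (L x)^(2n) maps into the kernel of rho,
   which L x kills. *)
have perp_nil x : perp x -> L x ^+ (n + n).+1 = 0.
  move=> Px; have Xn := isotropic_nilpotent x B0.
  have ad_pow k a b y : (n + n <= a + b + k)%N ->
      rho x ^+ a *m rho (L x ^+ k *m y) *m rho x ^+ b = 0.
    elim: k a b => [|k IHk] a b.
      rewrite addn0 => le_ab; have [le_na | lt_an] := leqP n a.
        by rewrite -(subnK le_na) exprD Xn mulr0 !mul0mx.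
      have le_nb : (n <= b)%N.
        by rewrite -(leq_add2l n) (leq_trans le_ab) // leq_add2r ltnW.
      by rewrite -(subnKC le_nb) exprD Xn mul0r mulmx0.
    rewrite addnS => le_abk.
    have expand Z : rho x ^+ a *m (rho x *m Z - Z *m rho x) *m rho x ^+ b =
        rho x ^+ a.+1 *m Z *m rho x ^+ b - rho x ^+ a *m Z *m rho x ^+ b.+1.
      by rewrite exprSr exprS -!mulmxE mulmxBr mulmxBl !mulmxA.
    rewrite exprS -mulmxE -[L x *m _ *m y]mulmxA rhoP expand.
    by rewrite !IHk ?subrr // ?addSn // addnS addSn.
  apply: mulmx_cV_eq0 => y; rewrite exprS -mulmxE -mulmxA perp_ker //.
  have := ad_pow (n + n)%N 0 0 y (leqnn _).
  by rewrite !expr0 mul1mx mulmx1.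
have Kxx x : perp x -> K x x = 0.
  move=> Px; apply: (@trace_nilpotent _ _ _ (n + n).+1).
  have -> : L x *m L x = L x ^+ 2 by rewrite expr2 mulmxE.
  by rewrite -exprM mulnC exprM perp_nil // expr0n.
have perpD x y : perp x -> perp y -> perp (x + y).
  by move=> Px Py z z0; rewrite trace_formDl Px ?Py ?addr0.
have Kperp x y : perp x -> perp y -> K x y = 0.
  move=> Px Py; have := Kxx _ (perpD _ _ Px Py).
  rewrite trace_formDl !trace_formDr !Kxx // add0r addr0 (trace_formC L y).
  by rewrite -mulr2n => /eqP; rewrite mulrn_eq0 => /eqP.
apply: (abelian_ideal_eq0 (P := perp)) => // x y Px Py.
apply: K_nondeg => z; rewrite killing_inv; apply: Kperp => //.
rewrite lie_antisym -mulmxN; apply: perp_ideal => w w0.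
by rewrite trace_formNl Py ?oppr0.
Qed.

End Representation.

(** * Casimir operators and the first Whitehead lemma *)

Local Notation e i := (delta_mx i 0 : 'cV[C]_d).
Local Notation f i := (dual i).

Section Casimir.
Variables (n : nat) (rho : {linear 'cV[C]_d -> 'M[C]_n}) (T : 'M[C]_d).
Hypothesis rhoP : lie_rep L rho.
Hypothesis T_comm : forall x, T *m L x = L x *m T.

(** For [g = rho] this is the Casimir operator of [rho] attached to [T] and [K]; for
    a cocycle [g], its coboundary is computed in [mul_casimir]. *)
Definition casimir m (g : {linear 'cV[C]_d -> 'M[C]_(n, m)}) : 'M[C]_(n, m) :=
  \sum_i rho (T *m e i) *m g (f i).

Lemma dual_ad x j : L x *m f j = \sum_i - (K (f j) (L x *m e i)) *: f i.
Proof.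
rewrite [LHS]dual_expand; apply: eq_bigr => i _; congr (_ *: _).
by rewrite -killing_inv lie_antisym trace_formNl trace_formC.
Qed.

(** The sum of the T e_i ⊗ f_i in the tensor square of [L] is invariant:
    by [dual_ad], the matrices of [L x] in the two dual bases are opposite
    transposes of each other. *)
Lemma casimir_invariant m (g : {linear 'cV[C]_d -> 'M[C]_(n, m)}) x :
  \sum_i rho (T *m (L x *m e i)) *m g (f i)
    + \sum_i rho (T *m e i) *m g (L x *m f i) = 0.
Proof.
have -> : \sum_i rho (T *m (L x *m e i)) *m g (f i) =
    \sum_i \sum_j K (f j) (L x *m e i) *: (rho (T *m e j) *m g (f i)).
  apply: eq_bigr => i _; set u := L x *m e i.
  rewrite {1}[u]cV_sum_delta mulmx_sumr linear_sum mulmx_suml.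
  apply: eq_bigr => j _.
  by rewrite K_dual // -scalemxAr linearZ -scalemxAl.
rewrite exchange_big -big_split big1 // => j _ /=.
rewrite dual_ad linear_sum mulmx_sumr -big_split big1 // => i _ /=.
by rewrite linearZ -scalemxAr scaleNr subrr.
Qed.

(** The coboundary of [casimir g] is the cocycle [g] multiplied by the Casimir
    operator.  The representation itself is a cocycle, which gives
    [casimir_comm]. *)
Lemma mul_casimir m (g : {linear 'cV[C]_d -> 'M[C]_(n, m)}) x :
    lie_cocycle L rho g ->
  rho x *m casimir g = casimir rho *m g x.
Proof.
move=> gP; rewrite /casimir mulmx_sumr mulmx_suml; apply/eqP.
rewrite -subr_eq0 -sumrB.
rewrite -[X in _ == X](casimir_invariant g x) -[X in _ == X]big_split.
apply/eqP/eq_bigr => i _ /=.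
have -> : rho (T *m (L x *m e i))
    = rho x *m rho (T *m e i) - rho (T *m e i) *m rho x.
  by rewrite mulmxA T_comm -mulmxA rhoP.
by rewrite gP mulmxBr mulmxBl !mulmxA [RHS]addrA subrK.
Qed.

Lemma casimir_comm x : rho x *m casimir rho = casimir rho *m rho x.
Proof. exact: mul_casimir. Qed.

End Casimir.

(** Choosing [T] as the conjugate part of the endomorphism [Th] that represents
    the trace form makes the trace of the Casimir operator a sum of squared moduli,
    so that it detects whether [Th] is nilpotent. *)
Lemma detecting_casimir n (rho : {linear 'cV[C]_d -> 'M[C]_n}) :
    lie_rep L rho ->
  exists2 T, (forall x, T *m L x = L x *m T) &
    forall k, casimir rho T rho ^+ k = 0 -> forall x, rho x = 0.
Proof.
move=> rhoP.
have [Th ThE] : exists Th, forall x y, trace_form rho x y = K (Th *m x) y.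
  exists (invmx (gram L) *m gram rho) => x y.
  rewrite !trace_form_gram !trmx_mul trmx_inv !tr_gram.
  by rewrite -!mulmxA mulKmx ?gram_unit.
have Th_comm x : Th *m L x = L x *m Th.
  apply/eqP; rewrite -subr_eq0; apply/eqP/mulmx_cV_eq0 => y.
  rewrite mulmxBl -!mulmxA; apply/eqP; rewrite subr_eq0; apply/eqP.
  apply: K_inj => z.
  rewrite -ThE lie_antisym trace_formNl (trace_form_inv rhoP) ThE.
  by rewrite -killing_inv lie_antisym trace_formNl opprK.
have [T [T_comm _ T_nil]] := conjugate_part Th [::] 0.
exists T => [x | k Om_nil]; first exact/T_comm/Th_comm.
apply: (isotropic_trivial rhoP).
have Th_nil : Th ^+ d = 0.
  apply: T_nil; rewrite -(trace_nilpotent Om_nil) /casimir raddf_sum.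
  rewrite [LHS]/mxtrace; apply: eq_bigr => i _ /=.
  rewrite -[\tr (_ *m _)]/(trace_form rho _ _) ThE trace_formC K_dual // mulmxA.
  by rewrite -colE [RHS]mxE.
move=> x y; rewrite ThE; apply: (@trace_nilpotent _ _ _ d).
have -> : L (Th *m x) = Th *m L x.
  apply/eqP; rewrite -subr_eq0; apply/eqP/mulmx_cV_eq0 => z.
  rewrite mulmxBl lie_antisym -mulmxA [L x *m z]lie_antisym mulmxN !mulmxA.
  by rewrite Th_comm subrr.
have comm : GRing.comm Th (L x *m L y).
  by rewrite /GRing.comm -!mulmxE mulmxA Th_comm -!mulmxA Th_comm.
by rewrite -mulmxA mulmxE exprMn_comm // Th_nil mul0r.
Qed.

(** Induction on the rank of a projector [eps] through which [rho] factors.  On the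
    range of the Fitting projector [e1] of the Casimir operator the cocycle is a
    coboundary; the complementary part of [rho] factors through [eps - e1], and
    keeping it on the same space avoids passing to subspaces. *)
Lemma whitehead_first_in_range r n (eps : 'M[C]_n) :
    (\rank eps <= r)%N -> eps *m eps = eps ->
  forall (rho : {linear 'cV[C]_d -> 'M[C]_n}),
    lie_rep L rho -> (forall x, eps *m rho x = rho x) ->
    (forall x, rho x *m eps = rho x) ->
  forall m (g : {linear 'cV[C]_d -> 'M[C]_(n, m)}),
    lie_cocycle L rho g ->
  exists M, forall x, g x = rho x *m M.
Proof.
elim: r eps => [|r IHr] eps le_eps_r eps_idem rho rhoP eps_rho rho_eps m g gP.
  exists 0 => x; rewrite mulmx0.
  have eps0 : eps = 0 by apply/eqP; rewrite -mxrank_eq0 -leqn0.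
  apply: linear_vanishing_on_brackets => {}x y.
  by rewrite gP -eps_rho -(eps_rho y) eps0 !mul0mx subrr.
have [T T_comm Om_nil] := detecting_casimir rhoP.
set Om := casimir rho T rho in Om_nil.
have [H [H_comm e_idem e_nz]] := fitting Om.
set e1 := Om *m H in e_idem e_nz.
have [e0 | e1_nz] := eqVneq e1 0.
  have [k /Om_nil rho0] := e_nz e0; exists 0 => x; rewrite mulmx0.
  apply: linear_vanishing_on_brackets => {}x y.
  by rewrite gP !rho0 !mul0mx subrr.
have Om_rho x : Om *m rho x = rho x *m Om by rewrite casimir_comm.
have e_rho x : e1 *m rho x = rho x *m e1.
  by rewrite /e1 -mulmxA H_comm // !mulmxA Om_rho.
have eps_Om : eps *m Om = Om.
  by rewrite mulmx_sumr; apply: eq_bigr => i _; rewrite mulmxA eps_rho.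
have Om_eps : Om *m eps = Om.
  by rewrite mulmx_suml; apply: eq_bigr => i _; rewrite -mulmxA rho_eps.
have H_eps : H *m eps = eps *m H by apply: H_comm; rewrite eps_Om.
have H_Om : H *m Om = Om *m H by apply: H_comm.
have e_eps : e1 *m eps = e1 by rewrite -mulmxA H_eps mulmxA Om_eps.
have eps_e : eps *m e1 = e1 by rewrite mulmxA eps_Om.
have e1E : e1 = Om *m H by [].
clearbody e1; pose eps' : 'M[C]_n := eps - e1.
have lt_rank : (\rank eps' <= r)%N.
  rewrite -ltnS (leq_trans _ le_eps_r) //.
  have eps'E : eps' = eps' *m eps by rewrite mulmxBl eps_idem e_eps.
  have sub : (eps' <= eps)%MS by rewrite eps'E submxMl.
  rewrite ltnNge; apply: contraNN e1_nz => le_rank; apply/eqP.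
  have /submxP[D epsE] : (eps <= eps')%MS.
    by rewrite -(geq_leqif (mxrank_leqif_sup sub)).
  by rewrite -eps_e epsE -mulmxA mulmxBl eps_e e_idem subrr mulmx0.
pose c : 'M[C]_n := 1%:M - e1.
have c_rho x : c *m rho x = rho x *m c.
  by rewrite mulmxBl mulmxBr mul1mx mulmx1 e_rho.
have c_idem : c *m c = c.
  by rewrite mulmxBr mulmx1 mulmxBl mul1mx e_idem subrr subr0.
have c_e : c *m e1 = 0 by rewrite mulmxBl mul1mx e_idem subrr.
have e_c : e1 *m c = 0 by rewrite mulmxBr mulmx1 e_idem subrr.
pose rho' : {linear 'cV[C]_d -> 'M[C]_n} := mulmx c \o rho.
pose g' : {linear 'cV[C]_d -> 'M[C]_(n, m)} := mulmx c \o g.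
have c_mul x p (Z : 'M_(n, p)) : rho' x *m (c *m Z) = c *m (rho x *m Z).
  by rewrite /= !mulmxA -[c *m _ *m c]mulmxA -c_rho mulmxA c_idem.
have [|||||M' g'E] := IHr eps' lt_rank _ rho' _ _ _ m g'.
- by rewrite mulmxBr !mulmxBl eps_idem e_eps eps_e e_idem subrr subr0.
- by move=> x y; rewrite !c_mul /= rhoP mulmxBr.
- by move=> x; rewrite /= mulmxA mulmxBl e_c subr0 -mulmxA c_rho mulmxA eps_rho.
- move=> x; rewrite /= mulmxBr -!mulmxA rho_eps -e_rho.
  by rewrite [c *m (e1 *m _)]mulmxA c_e mul0mx subr0.
- by move=> x y; rewrite !c_mul -mulmxBr /= gP.
pose m0 := casimir rho T g.
exists (H *m m0 + c *m M') => x.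
have -> : g x = e1 *m g x + g' x by rewrite /= -mulmxDl addrC subrK mul1mx.
rewrite g'E mulmxDr; congr (_ + _); last by rewrite /= c_rho mulmxA.
rewrite mulmxA -(H_comm _ (Om_rho x)) -mulmxA (mul_casimir rhoP T_comm) //.
by rewrite mulmxA H_Om -e1E.
Qed.

Theorem whitehead_first n (rho : {linear 'cV[C]_d -> 'M[C]_n}) m
    (g : {linear 'cV[C]_d -> 'M[C]_(n, m)}) :
    lie_rep L rho ->
    lie_cocycle L rho g ->
  exists M, forall x, g x = rho x *m M.
Proof.
move=> rhoP; apply: (whitehead_first_in_range (rank_leq_row 1%:M)) => // [|x|x].
- by rewrite mulmx1.
- by rewrite mul1mx.
- by rewrite mulmx1.
Qed.

(** * Weyl's theorem *)

(** The range of [p] is a subrepresentation U.  The defect [rho x *m p - p *m rho x]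
    is a 1-cocycle with values in Hom(V / U, U), and writing it as the coboundary of
    [Z] makes [p - Z] equivariant.  To avoid quotients, this Hom space is enlarged to
    all square matrices, on which [x] acts by
    [Z |-> rho x *m p *m Z - Z *m (1%:M - p) *m rho x]; matrices are flattened to
    columns of height [n * n]. *)
Theorem weyl_equivariant_projection n (rho : {linear 'cV[C]_d -> 'M[C]_n}) (p : 'M[C]_n) :
    lie_rep L rho -> p *m p = p ->
    (forall x, p *m rho x *m p = rho x *m p) ->
  exists q, [/\ p *m q = q, q *m p = p & forall x, q *m rho x = rho x *m q].
Proof.
move=> rhoP pp stable.
pose c : 'M[C]_n := 1%:M - p.
have cc : c *m c = 1%:M - p.
  by rewrite mulmxBr mulmx1 mulmxBl mul1mx pp subrr subr0.
have costable x : c *m rho x *m c = c *m rho x.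
  by rewrite [LHS]mulmxBr mulmx1 !mulmxBl mul1mx stable subrr subr0.
have cE : c = 1%:M - p by [].
clearbody c; pose act x : 'M[C]_(n * n) :=
  (lin_mulmx (rho x *m p) - lin_mulmxr (c *m rho x))^T.
have actE x (Z : 'M_n) : act x *m (mxvec Z)^T =
    (mxvec (rho x *m p *m Z - Z *m (c *m rho x)))^T.
  by rewrite -trmx_mul mulmxBr !mul_vec_lin /= -linearB.
have act_ext (X Y : 'M[C]_(n * n)) :
    (forall Z : 'M_n, X *m (mxvec Z)^T = Y *m (mxvec Z)^T) -> X = Y.
  move=> XY; apply/eqP; rewrite -subr_eq0; apply/eqP/mulmx_cV_eq0 => v.
  by rewrite mulmxBl -[v]trmxK -[v^T]vec_mxK XY subrr.
have act_lin : linear act.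
  move=> a x y; apply: act_ext => Z; rewrite mulmxDl -scalemxAl !actE.
  rewrite -linearP /= -linearP /=; congr (mxvec _)^T; rewrite linearP.
  rewrite !mulmxDl !mulmxDr -!scalemxAl -!scalemxAr scalerBr opprD addrACA.
  by rewrite -!mulmxA.
pose act' := GRing.isLinear.Build _ _ _ _ act act_lin.
pose sigma : {linear 'cV[C]_d -> 'M[C]_(n * n)} := HB.pack act act'.
pose coc x : 'cV[C]_(n * n) := (mxvec (rho x *m p - p *m rho x))^T.
have coc_lin : linear coc.
  move=> a x y; rewrite /coc -linearP /= -linearP /=; congr (mxvec _)^T.
  by rewrite linearP mulmxDl mulmxDr -scalemxAl -scalemxAr scalerBr opprD addrACA.
pose coc' := GRing.isLinear.Build _ _ _ _ coc coc_lin.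
pose g : {linear 'cV[C]_d -> 'cV[C]_(n * n)} := HB.pack coc coc'.
have alpha x y : rho x *m p *m (rho y *m p) = rho x *m rho y *m p.
  by rewrite -!mulmxA [p *m (_ *m p)]mulmxA stable.
have beta x y : c *m rho x *m (c *m rho y) = c *m rho x *m rho y.
  by rewrite !mulmxA costable.
have sigmaP : lie_rep L sigma.
  move=> x y; apply: act_ext => Z; rewrite mulmxBl -!mulmxA !actE.
  rewrite -linearB -linearB /=; congr ((mxvec _)^T).
  have -> : rho (L x *m y) *m p
      = rho x *m p *m (rho y *m p) - rho y *m p *m (rho x *m p).
    by rewrite !alpha rhoP mulmxBl.
  have -> : c *m rho (L x *m y)
      = c *m rho x *m (c *m rho y) - c *m rho y *m (c *m rho x).
    by rewrite !beta rhoP mulmxBr !mulmxA.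
  move: (rho x *m p) (rho y *m p) (c *m rho x) (c *m rho y) => a b u v.
  rewrite !(mulmxBl, mulmxBr) !mulmxA.
  move: (a *m b *m Z) (b *m a *m Z) (Z *m u *m v) (Z *m v *m u) => ab ba uv vu.
  move: (a *m Z *m v) (b *m Z *m u) => av bu.
  by apply/matrixP=> i j; rewrite !mxE; ring.
have gP : lie_cocycle L sigma g.
  move=> y z; rewrite !actE -linearB -linearB /=; congr ((mxvec _)^T).
  have coc_act u v : rho u *m p *m (rho v *m p - p *m rho v)
      - (rho v *m p - p *m rho v) *m (c *m rho u) =
    rho u *m rho v *m p - rho u *m p *m rho v
      + p *m rho v *m rho u - rho v *m p *m rho u.
    rewrite mulmxBr alpha mulmxBl !mulmxA -[rho u *m p *m p]mulmxA pp.
    have -> : rho v *m p *m c = 0.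
      by rewrite -mulmxA cE mulmxBr mulmx1 pp subrr mulmx0.
    have -> : p *m rho v *m c = p *m rho v - rho v *m p.
      by rewrite cE mulmxBr mulmx1 stable.
    by rewrite mul0mx sub0r opprK mulmxBl addrA.
  rewrite !coc_act rhoP mulmxBl mulmxBr !mulmxA.
  move: (rho y *m p *m rho z) (rho z *m p *m rho y) => A B.
  move: (rho y *m rho z *m p) (rho z *m rho y *m p) => A' B'.
  move: (p *m rho y *m rho z) (p *m rho z *m rho y) => A'' B''.
  by apply/matrixP=> i j; rewrite !mxE; ring.
have [M gE] := whitehead_first sigmaP gP.
(* Compressing Z0 by p and c brings it back into Hom(V / U, U). *)
pose Z0 : 'M_n := vec_mx M^T; pose Z : 'M_n := p *m Z0 *m c.
have pc : p *m c = 0 by rewrite cE mulmxBr mulmx1 pp subrr.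
have cp : c *m p = 0 by rewrite cE mulmxBl mul1mx pp subrr.
have cobound x : rho x *m p - p *m rho x = rho x *m Z - Z *m rho x.
  have := gE x; rewrite -[M]trmxK -[M^T]vec_mxK actE -/Z0.
  move=> /trmx_inj/(can_inj mxvecK) /(congr1 (fun X => p *m X *m c)).
  rewrite !mulmxBr !mulmxBl !mulmxA stable.
  rewrite -[rho x *m p *m c]mulmxA pc mulmx0 pp sub0r.
  rewrite [in LHS]cE mulmxBr mulmx1 stable opprB => ->.
  by rewrite /Z -!mulmxA [c *m (rho x *m c)]mulmxA costable.
exists (p - Z); split=> [||x].
- by rewrite mulmxBr pp /Z !mulmxA pp.
- by rewrite mulmxBl pp /Z -!mulmxA cp !mulmx0 subr0.
rewrite mulmxBl mulmxBr -[rho x *m p](subrK (p *m rho x)) cobound.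
by rewrite [RHS]addrC !addrA addNr add0r [RHS]addrC.
Qed.

End Semisimple.

(** * Endomorphisms as matrices acting on columns *)

Section Coordinates.
Variables (F : fieldType) (W : vectType F).
Local Notation d := (\dim {:W}).
Local Notation e := (vbasis {:W}).
Implicit Types (f : 'End(W)) (w : W) (v : 'cV[F]_d).

(** Coordinates are columns rather than rows, so that the matrix of a composition
    is the product of the matrices in the same order. *)
Definition cvec w : 'cV[F]_d := (rVof e w)^T.
Definition vecc v : W := vecof e v^T.
Definition opmx f : 'M[F]_d := (mxof e e f)^T.
Definition mxop (X : 'M[F]_d) : 'End(W) := hommx e e X^T.

Let e_basis : basis_of {:W} e := vbasisP {:W}.

Lemma cvec_linear : linear cvec.
Proof. by move=> a u v; rewrite /cvec !linearP. Qed.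
HB.instance Definition _ := GRing.isLinear.Build F _ _ _ cvec cvec_linear.

Lemma vecc_linear : linear vecc.
Proof. by move=> a u v; rewrite /vecc !linearP. Qed.
HB.instance Definition _ := GRing.isLinear.Build F _ _ _ vecc vecc_linear.

Lemma opmx_linear : linear opmx.
Proof. by move=> a u v; rewrite /opmx !linearP. Qed.
HB.instance Definition _ := GRing.isLinear.Build F _ _ _ opmx opmx_linear.

Lemma cvecK : cancel cvec vecc.
Proof. by move=> w; rewrite /vecc trmxK rVofK. Qed.

Lemma veccK : cancel vecc cvec.
Proof. by move=> v; rewrite /cvec vecofK // trmxK. Qed.

Lemma mxopK : cancel mxop opmx.
Proof. by move=> X; rewrite /opmx hommxK // trmxK. Qed.

Lemma opmxK : cancel opmx mxop.
Proof. by move=> f; rewrite /mxop trmxK mxofK. Qed.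

Lemma cvec_app f w : cvec (f w) = opmx f *m cvec w.
Proof. by rewrite /cvec /opmx -trmx_mul -rVof_app. Qed.

Lemma opmx_comp f g : opmx (f \o g)%VF = opmx f *m opmx g.
Proof. by rewrite /opmx (mxof_comp _ _ e_basis) trmx_mul. Qed.

Lemma lfun_traceE f : lfun_trace f = \tr (opmx f).
Proof. by rewrite mxtrace_tr. Qed.

Lemma lfun_traceC f g : lfun_trace (f \o g)%VF = lfun_trace (g \o f)%VF.
Proof. by rewrite !lfun_traceE !opmx_comp mxtrace_mulC. Qed.

End Coordinates.

(** * Removing the signs *)

Section Signs.
Variable F : fieldType.
Implicit Types a b c : Z22.

Lemma Z2_ind (P : 'Z_2 -> Prop) : P 0 -> P 1 -> forall u, P u.
Proof.
move=> P0 P1 [[|[|m]] lt_m2] //.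
  by rewrite (_ : Ordinal _ = 0) //; apply: val_inj.
by rewrite (_ : Ordinal _ = 1) //; apply: val_inj.
Qed.

Definition sgn (u : 'Z_2) : F := (-1) ^+ u.

Lemma sgnD u v : sgn (u + v) = sgn u * sgn v.
Proof.
elim/Z2_ind: u; elim/Z2_ind: v; rewrite /sgn /= ?expr0 ?expr1 ?mulr1 ?mul1r //.
by rewrite mulrNN mulr1.
Qed.

Lemma sgn_sq u : sgn u * sgn u = 1.
Proof. by rewrite -sgnD; elim/Z2_ind: u. Qed.

Lemma sgn_neq0 u : sgn u != 0.
Proof. by rewrite signr_eq0. Qed.

Definition sign_cocycle a b : F := sgn (a.2 * b.1).

Lemma sign_cocycleDr a b c : sign_cocycle a (b + c) = sign_cocycle a b * sign_cocycle a c.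
Proof. by rewrite /sign_cocycle mulrDr sgnD. Qed.

Lemma sign_cocycleDl a b c : sign_cocycle (a + b) c = sign_cocycle a c * sign_cocycle b c.
Proof. by rewrite /sign_cocycle mulrDl sgnD. Qed.

Lemma sign_cocycle_sq a b : sign_cocycle a b * sign_cocycle a b = 1.
Proof. exact: sgn_sq. Qed.

(** The identity that turns graded antisymmetry into antisymmetry. *)
Lemma sign_cocycle_sign a b : sign_cocycle a b * z22_sign F a b = sign_cocycle b a.
Proof.
rewrite /sign_cocycle /z22_sign /z22_pair -/(sgn (a.1 * b.2 - a.2 * b.1)) -sgnD.
by congr sgn; rewrite addrC subrK mulrC.
Qed.

(** The tensor product of [X] with diag(1, -1)^(a.1) (0 1; 1 0)^(a.2). *)
Definition pauli n (a : Z22) (X : 'M[F]_n) : 'M[F]_(n + n) :=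
  if a.2 == 0 then block_mx X 0 0 (sgn a.1 *: X)
  else block_mx 0 X (sgn a.1 *: X) 0.

Lemma pauli_mul n a b (X Y : 'M[F]_n) :
  pauli a X *m pauli b Y = sign_cocycle a b *: pauli (a + b) (X *m Y).
Proof.
rewrite /sign_cocycle /pauli; case: a b => a1 a2 [b1 b2] /=; have tt := sgn_sq b1.
by elim/Z2_ind: a2; elim/Z2_ind: b2;
  rewrite /= ?addr0 ?add0r ?(addr0, eqxx) /= mulmx_block
    !(mulmx0, mul0mx, addr0, add0r) ?mul0r ?mul1r ?scale1r ?scale_block_mx
    ?scaler0 -?scalemxAl -?scalemxAr !scalerA -?scalemxAl ?scalerA sgnD
    ?(mulrCA _ (sgn a1)) ?tt ?mulr1.
Qed.

Lemma pauli_linear n a : linear (@pauli n a).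
Proof.
move=> k X Y; rewrite /pauli; case: ifP => _;
by rewrite scale_block_mx add_block_mx !scaler0 !addr0 scalerDr !scalerA (mulrC k).
Qed.
HB.instance Definition _ n a :=
  GRing.isLinear.Build F _ _ _ (@pauli n a) (pauli_linear a).

End Signs.

Section Grading.
Variables (F : fieldType) (g : z22Lie F).
Implicit Types (a b c : Z22) (x y z : g).

Definition gproj a : 'End(g) := sumv_pi_for (esym (grade_full g)) a.

Lemma gproj_mem a x : gproj a x \in grade g a.
Proof. exact: memv_sum_pi. Qed.

Lemma gproj_sum x : \sum_a gproj a x = x.
Proof. by apply: sumv_pi_sum; apply: memvf. Qed.

Lemma gprojE a b x :
  x \in grade g a -> gproj b x = if b == a then x else 0.
Proof.
move=> xa; have /directv_sum_unique uniq := grade_direct g.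
have := uniq (fun c => gproj c x) (fun c => if c == a then x else 0)
  (fun c _ => gproj_mem c x).
rewrite gproj_sum -big_mkcond big_pred1_eq eqxx => /(_ _)/esym/forall_inP all_eq.
by apply/eqP/all_eq => // c _; case: eqP => [->|_]; rewrite ?mem0v.
Qed.

Lemma homogeneous_ind (P : g -> Prop) :
    (forall a x, x \in grade g a -> P x) -> (forall x y, P x -> P y -> P (x + y)) ->
  forall x, P x.
Proof.
move=> Phom Padd x; rewrite -(gproj_sum x); elim/big_ind: _ => // [|a _].
  exact: (Phom 0 0 (mem0v _)).
exact: Phom (gproj_mem a x).
Qed.

(** A map that shifts degrees has no diagonal block. *)
Lemma trace_shift (f : 'End(g)) c : c != 0 ->
  (forall a x, x \in grade g a -> f x \in grade g (c + a)) -> lfun_trace f = 0.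
Proof.
move=> c_neq0 f_shift.
have -> : f = \sum_a (f \o (gproj a \o gproj a))%VF.
  apply/lfunP=> x; rewrite sum_lfunE -{1}(gproj_sum x) linear_sum.
  apply: eq_bigr => a _.
  by rewrite !comp_lfunE (gprojE a (gproj_mem a x)) eqxx.
rewrite lfun_traceE !linear_sum big1 // => a _ /=.
rewrite -lfun_traceE comp_lfunA lfun_traceC lfun_traceE.
suff -> : (gproj a \o (f \o gproj a))%VF = 0 by rewrite linear0 mxtrace0.
apply/lfunP=> x; rewrite !comp_lfunE lfunE /=.
rewrite (gprojE _ (f_shift _ _ (gproj_mem a x))) ifN //.
by rewrite -subr_eq0 opprD addrCA subrr addr0 oppr_eq0.
Qed.

(** Adjoint map of the ordinary Lie bracket; [twistedE] gives it on homogeneous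
    elements. *)
Definition twisted x : 'End(g) :=
  \sum_a \sum_b sign_cocycle F a b *: (ad g (gproj a x) \o gproj b)%VF.

Lemma twisted_linear : linear twisted.
Proof.
move=> k x y; rewrite /twisted scaler_sumr -big_split; apply: eq_bigr => a _ /=.
rewrite scaler_sumr -big_split; apply: eq_bigr => b _ /=.
by rewrite !linearP /= comp_lfunDl -comp_lfunZl scalerDr !scalerA mulrC.
Qed.
HB.instance Definition _ := GRing.isLinear.Build F _ _ _ twisted twisted_linear.

Lemma twistedE a b x y : x \in grade g a -> y \in grade g b ->
  twisted x y = sign_cocycle F a b *: ad g x y.
Proof.
move=> xa yb; rewrite /twisted sum_lfunE.
rewrite (bigD1 a) //= [X in _ + X]big1 ?addr0 => [|c neq_ca].
  rewrite sum_lfunE (bigD1 b) //= [X in _ + X]big1 ?addr0 => [|c neq_cb];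
    rewrite scale_lfunE comp_lfunE (gprojE _ yb).
    by rewrite (gprojE _ xa) !eqxx.
  by rewrite (negPf neq_cb) linear0 scaler0.
rewrite sum_lfunE big1 // => b' _.
rewrite scale_lfunE comp_lfunE (gprojE _ xa) (negPf neq_ca).
by rewrite linear0 lfunE scaler0.
Qed.

Lemma twisted_grade a b x y : x \in grade g a -> y \in grade g b ->
  twisted x y \in grade g (a + b).
Proof. by move=> xa yb; rewrite (twistedE xa yb) memvZ // bracket_grade. Qed.

Lemma twisted_antisym x y : twisted x y = - twisted y x.
Proof.
elim/homogeneous_ind: x => [a x xa|x x' IHx IHx']; last first.
  by rewrite linearD add_lfunE IHx IHx' linearD opprD.
elim/homogeneous_ind: y => [b y yb|y y' IHy IHy']; last first.
  by rewrite [twisted (_ + _)]linearD add_lfunE opprD -IHy -IHy' linearD.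
rewrite (twistedE xa yb) (twistedE yb xa) (bracket_antisym xa yb).
by rewrite scalerN scalerA sign_cocycle_sign.
Qed.

Lemma twisted_jacobi x y z :
  twisted (twisted x y) z = twisted x (twisted y z) - twisted y (twisted x z).
Proof.
elim/homogeneous_ind: x => [a x xa|x x' IHx IHx']; last first.
  by rewrite !linearD !add_lfunE !linearD add_lfunE /= IHx IHx' ?opprD addrACA.
elim/homogeneous_ind: y => [b y yb|y y' IHy IHy']; last first.
  by rewrite !linearD !add_lfunE IHy IHy' !linearD /= ?opprD addrACA.
elim/homogeneous_ind: z => [c z zc|z z' IHz IHz']; last first.
  by rewrite !linearD /= IHz IHz' ?opprD addrACA.
rewrite (twistedE (twisted_grade xa yb) zc) (twistedE xa (twisted_grade yb zc)).
rewrite (twistedE yb (twisted_grade xa zc)) (twistedE xa yb) (twistedE yb zc).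
rewrite (twistedE xa zc) !linearZ /= (bracket_jacobi z xa yb).
rewrite !scalerDr !scalerA -addrA sign_cocycleDl !sign_cocycleDr lfunE /= scalerA.
set u := ad g (ad g x y) z; set w := ad g y (ad g x z).
rewrite scalerN -scalerBl (_ : _ - _ = 0); last first.
  by rewrite -(sign_cocycle_sign F a b); ring.
by rewrite scale0r addr0; congr (_ *: _); ring.
Qed.

Lemma twisted_comp x y :
  twisted (twisted x y)
    = ((twisted x \o twisted y) - (twisted y \o twisted x))%VF.
Proof.
by apply/lfunP=> z; rewrite twisted_jacobi; do !rewrite lfunE /=.
Qed.

Lemma addZ22_neq0 a b : b != a -> a + b != 0.
Proof.
apply: contra_neq => /eqP; rewrite addr_eq0 => /eqP->.
by case: b => b1 b2; apply/eqP; elim/Z2_ind: b1; elim/Z2_ind: b2.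
Qed.

Lemma killing_orthogonal a b x y :
  x \in grade g a -> y \in grade g b -> b != a -> killing x y = 0.
Proof.
move=> xa yb /addZ22_neq0 ab_neq0; apply: (trace_shift ab_neq0) => c z zc.
by rewrite comp_lfunE -addrA (bracket_grade xa (bracket_grade yb zc)).
Qed.

(** Between different degrees both sides vanish.  For [a = b] the signs picked up
    by a vector of degree [c] are [sign_cocycle a (a + c)] and [sign_cocycle a c],
    and their product does not depend on [c]. *)
Lemma twisted_killing a b x y : x \in grade g a -> y \in grade g b ->
  lfun_trace (twisted x \o twisted y)%VF = sign_cocycle F a b * killing x y.
Proof.
move=> xa yb; have [eq_ba | neq_ba] := eqVneq b a; last first.
  rewrite (killing_orthogonal xa yb neq_ba) mulr0.
  apply: (trace_shift (addZ22_neq0 neq_ba)) => c z zc.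
  by rewrite comp_lfunE -addrA (twisted_grade xa (twisted_grade yb zc)).
rewrite {}eq_ba in yb *.
have -> : (twisted x \o twisted y)%VF = sign_cocycle F a a *: (ad g x \o ad g y)%VF.
  apply/lfunP=> z; elim/homogeneous_ind: z => [c z zc|z z' IHz IHz']; last first.
    by rewrite !linearD /= IHz IHz'.
  rewrite scale_lfunE !comp_lfunE (twistedE yb zc) linearZ /=.
  rewrite (twistedE xa (bracket_grade yb zc)) scalerA sign_cocycleDr.
  by rewrite mulrC -mulrA sign_cocycle_sq mulr1.
by rewrite /killing !lfun_traceE linearZ /= mxtraceZ.
Qed.

Local Notation d := (\dim {:g}).

Definition discolored_ad (v : 'cV[F]_d) : 'M[F]_d := opmx (twisted (vecc v)).

Lemma discolored_ad_linear : linear discolored_ad.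
Proof. by move=> k u v; rewrite /discolored_ad !linearP. Qed.
HB.instance Definition _ :=
  GRing.isLinear.Build F _ _ _ discolored_ad discolored_ad_linear.

Lemma discolored_adE u v : discolored_ad u *m v = cvec (twisted (vecc u) (vecc v)).
Proof. by rewrite cvec_app veccK. Qed.

Fact discolored_antisym u v : discolored_ad u *m v = - (discolored_ad v *m u).
Proof. by rewrite !discolored_adE twisted_antisym linearN. Qed.

Fact discolored_jacobi u v :
  discolored_ad (discolored_ad u *m v) =
    discolored_ad u *m discolored_ad v - discolored_ad v *m discolored_ad u.
Proof.
rewrite [in LHS]discolored_adE /discolored_ad cvecK twisted_comp -!opmx_comp.
exact: linearB.
Qed.

Definition discolored : lieAlgebra F d :=
  LieAlgebra discolored_antisym discolored_jacobi.

Lemma discolored_nondegenerate :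
  killing_nondegenerate g -> nondegenerate_killing discolored.
Proof.
move=> K_nondeg v v0; rewrite -[v]veccK; set x := vecc v.
have Kt y : lfun_trace (twisted x \o twisted y)%VF = 0.
  by rewrite lfun_traceE opmx_comp -(v0 (cvec y)) /trace_form /= /discolored_ad cvecK.
suff -> : x = 0 by rewrite linear0.
rewrite -(gproj_sum x) big1 // => a _; apply: K_nondeg => y.
elim/homogeneous_ind: y => [b y yb|y y' IHy IHy']; last first.
  rewrite /killing linearD /= comp_lfunDr lfun_traceE !linearD /=.
  by rewrite -!lfun_traceE -!/(killing _ _) IHy IHy' addr0.
have [eq_ba | neq_ba] := eqVneq b a; last first.
  exact: (killing_orthogonal (gproj_mem a x) yb neq_ba).
rewrite {}eq_ba in yb.
apply: (mulfI (sgn_neq0 F (a.2 * a.1))).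
rewrite mulr0 -[_ * _](twisted_killing (gproj_mem a x) yb) -[RHS](Kt y).
have -> : lfun_trace (twisted x \o twisted y)%VF
    = \sum_c lfun_trace (twisted (gproj c x) \o twisted y)%VF.
  have {1}-> : twisted x = \sum_c twisted (gproj c x).
    by rewrite -[X in twisted X](gproj_sum x) [LHS]linear_sum.
  rewrite lfun_traceE opmx_comp [opmx (\sum_c _)]linear_sum mulmx_suml linear_sum.
  by apply: eq_bigr => c _; rewrite lfun_traceE opmx_comp.
rewrite (bigD1 a) //= [X in _ = _ + X]big1 ?addr0 // => c neq_ca.
rewrite (twisted_killing (gproj_mem c x) yb).
by rewrite (killing_orthogonal (gproj_mem c x) yb) ?mulr0 // eq_sym.
Qed.

End Grading.

Section DiscoloredRepresentation.
Variables (F : fieldType) (g : z22Lie F) (V : vectType F).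
Variable phi : 'Hom(g, 'End(V)).
Hypothesis phiP : is_representation phi.
Local Notation d := (\dim {:g}).
Local Notation n := (\dim {:V}).

Definition discolored_rho (v : 'cV[F]_d) : 'M[F]_(n + n) :=
  \sum_a pauli a (opmx (phi (gproj g a (vecc v)))).

Lemma discolored_rho_linear : linear discolored_rho.
Proof.
move=> k u v; rewrite /discolored_rho scaler_sumr -big_split; apply: eq_bigr => a _.
by rewrite !linearP.
Qed.
HB.instance Definition _ :=
  GRing.isLinear.Build F _ _ _ discolored_rho discolored_rho_linear.

Lemma discolored_rhoE a x : x \in grade g a ->
  discolored_rho (cvec x) = pauli a (opmx (phi x)).
Proof.
move=> xa; rewrite /discolored_rho cvecK (bigD1 a) //= big1 ?addr0 => [|b neq_ba].
  by rewrite (gprojE _ xa) eqxx.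
by rewrite (gprojE _ xa) (negPf neq_ba) !linear0.
Qed.

Lemma discolored_rhoP : lie_rep (discolored g) discolored_rho.
Proof.
move=> u v; rewrite -[u]veccK -[v]veccK; move: (vecc u) (vecc v) => {u v} x y.
rewrite [_ *m _]discolored_adE !cvecK.
elim/homogeneous_ind: x => [a x xa|x x' IHx IHx']; last first.
  rewrite !linearD add_lfunE !linearD ?mulmxDl ?mulmxDr /= IHx IHx' ?opprD.
  by rewrite addrACA.
elim/homogeneous_ind: y => [b y yb|y y' IHy IHy']; last first.
  rewrite !linearD ?mulmxDl ?mulmxDr /= IHy IHy' ?opprD.
  by rewrite addrACA.
rewrite (twistedE xa yb) !linearZ /= (discolored_rhoE (bracket_grade xa yb)).
rewrite (discolored_rhoE xa) (discolored_rhoE yb) !pauli_mul (phiP xa yb).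
rewrite -(sign_cocycle_sign F a b) [b + a]addrC linearB linearZ /= !opmx_comp.
by rewrite linearB linearZ /= scalerBr scalerA.
Qed.

(** The matrix gamma_a is diagonal or antidiagonal with signs as entries, so either
    [X] commutes with both diagonal blocks of [Q], or it exchanges them; in both
    cases it commutes with their sum. *)
Lemma pauli_commute a (X : 'M[F]_n) (Q : 'M[F]_(n + n)) :
    Q *m pauli a X = pauli a X *m Q ->
  (ulsubmx Q + drsubmx Q) *m X = X *m (ulsubmx Q + drsubmx Q).
Proof.
rewrite -{1 2}[Q]submxK /pauli; case: eqP => _; rewrite !mulmx_block;
  rewrite !(mulmx0, mul0mx, addr0, add0r) => /eq_block_mx[].
  rewrite -!scalemxAl -!scalemxAr => ulE _ _ /(scalerI (sgn_neq0 _ _)) drE.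
  by rewrite mulmxDl mulmxDr ulE drE.
rewrite -!scalemxAl -!scalemxAr => _ ulE drE _.
rewrite mulmxDl mulmxDr ulE addrC; congr (_ + _).
exact: (scalerI (sgn_neq0 F a.1)).
Qed.

End DiscoloredRepresentation.

(** * Complements and the decomposition *)

Section Complement.
Variables (C : numClosedFieldType) (g : z22Lie C) (V : vectType C).
Variable (phi : 'Hom(g, 'End(V))).
Hypothesis phiP : is_representation phi.
Hypothesis K_nondeg : killing_nondegenerate g.

(** Both diagonal blocks of the projector onto C^2 ⊗ U are projectors onto U, and
    so is their mean, which moreover commutes with [phi] by [pauli_commute]. *)
Lemma subrep_complement U : subrepresentation phi U ->
  exists W,
    [/\ subrepresentation phi W, (U :&: W = 0)%VS & (U + W = fullv)%VS].
Proof.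
move=> U_sub.
pose p := opmx (projv U).
have pp : p *m p = p.
  by rewrite -opmx_comp; congr opmx; apply/lfunP=> v; rewrite comp_lfunE projv_proj.
have p_stable x : p *m opmx (phi x) *m p = opmx (phi x) *m p.
  rewrite -mulmxA -!opmx_comp; congr opmx; apply/lfunP=> v.
  by rewrite !comp_lfunE projv_id // U_sub // memv_proj.
pose P := block_mx p 0 0 p.
have PP : P *m P = P by rewrite mulmx_block !(mulmx0, mul0mx, addr0, add0r) pp.
have P_stable v : P *m discolored_rho phi v *m P = discolored_rho phi v *m P.
  rewrite -[v]veccK.
  elim/homogeneous_ind: (vecc v) => [a x xa|x y IHx IHy]; last first.
    have -> : discolored_rho phi (cvec (x + y))
        = discolored_rho phi (cvec x) + discolored_rho phi (cvec y).
      by rewrite 2!linearD.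
    move: (discolored_rho phi (cvec x)) (discolored_rho phi (cvec y)) IHx IHy.
    by move: P {PP} => Q A B IHx IHy; rewrite mulmxDr !mulmxDl IHx IHy.
  rewrite (discolored_rhoE phi xa) /pauli; case: ifP => _;
  by rewrite !mulmx_block !(mulmx0, mul0mx, addr0, add0r) -?scalemxAl
             -?scalemxAr -?scalemxAl p_stable.
have [Q [PQ QP Q_comm]] :=
  weyl_equivariant_projection (discolored_nondegenerate K_nondeg)
    (discolored_rhoP phiP) PP P_stable.
pose q : 'M[C]_(\dim {:V}) := (2^-1 : C) *: (ulsubmx Q + drsubmx Q).
have two : (2 : C) != 0 by rewrite pnatr_eq0.
have half (X : 'M[C]_(\dim {:V})) : 2^-1 *: (X + X) = X.
  by rewrite -mulr2n -scaler_nat scalerA mulVf ?scale1r.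
have pq : p *m q = q.
  move: PQ; rewrite -{1 2}[Q]submxK mulmx_block !(mul0mx, addr0, add0r).
  by case/eq_block_mx => ul _ _ dr; rewrite -scalemxAr mulmxDr ul dr.
have qp : q *m p = p.
  move: QP; rewrite -{1}[Q]submxK mulmx_block !(mulmx0, addr0, add0r).
  by case/eq_block_mx => ul _ _ dr; rewrite -scalemxAl mulmxDl ul dr half.
have q_comm x : q *m opmx (phi x) = opmx (phi x) *m q.
  elim/homogeneous_ind: x => [a x xa|x y IHx IHy]; last first.
    by rewrite !linearD /= mulmxDl IHx IHy.
  rewrite -scalemxAl -scalemxAr; congr (_ *: _); apply: (@pauli_commute _ _ a).
  by rewrite -(discolored_rhoE phi xa); apply: (Q_comm (cvec x)).
pose f := mxop q.
have f_U v : f v \in U.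
  have -> : f = (projv U \o f)%VF.
    by apply: (can_inj (@opmxK _ _)); rewrite opmx_comp mxopK.
  by rewrite comp_lfunE memv_proj.
have f_id v : v \in U -> f v = v.
  move=> vU; rewrite -{1}(projv_id vU) -comp_lfunE.
  have -> : (f \o projv U)%VF = projv U.
    by apply: (can_inj (@opmxK _ _)); rewrite opmx_comp mxopK.
  exact: projv_id.
have f_comm x v : f (phi x v) = phi x (f v).
  rewrite -!comp_lfunE; congr (fun_of_lfun _ v); apply: (can_inj (@opmxK _ _)).
  by rewrite !opmx_comp mxopK.
exists (lker f); split.
- by move=> x v; rewrite !memv_ker f_comm => /eqP->; rewrite linear0.
- apply/eqP; rewrite -subv0; apply/subvP=> v; rewrite memv_cap memv_ker memv0.
  by case/andP=> /f_id->.
apply/eqP; rewrite eqEsubv subvf; apply/subvP=> v _.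
rewrite -[v](subrK (f v)) addrC memv_add ?f_U //.
by rewrite memv_ker linearB /= (f_id (f v)) ?subrr.
Qed.

Lemma subrep_cap U W : subrepresentation phi U -> subrepresentation phi W ->
  subrepresentation phi (U :&: W)%VS.
Proof.
by move=> U_sub W_sub x v; rewrite !memv_cap => /andP[vU vW]; rewrite U_sub ?W_sub.
Qed.

(** Directness of the sum is recorded by the dimensions, so that decompositions can
    be concatenated. *)
Lemma subrep_decomposition U : subrepresentation phi U ->
  exists s : seq {vspace V},
    [/\ forall W, W \in s -> irreducible_subrep phi W,
        (\sum_(W <- s) W)%VS = U & (\sum_(W <- s) \dim W)%N = \dim U].
Proof.
have [m] := ubnP (\dim U); elim: m U => // m IHm U; rewrite ltnS => le_Um U_sub.
have [-> | U_neq0] := eqVneq U 0%VS.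
  by exists [::]; rewrite !big_nil dimv0.
have [[U1 [U1U U1_sub U1_neq0 U1_neqU]] | no_U1] :=
  EM (exists U1 : {vspace V}, [/\ (U1 <= U)%VS, subrepresentation phi U1,
                                U1 != 0%VS & U1 != U]); last first.
  exists [:: U]; rewrite !big_seq1; split=> // W; rewrite inE => /eqP->.
  split=> // [|U1 U1U U1_sub]; first exact/eqP.
  have [-> | U1_neq0] := eqVneq U1 0%VS; [by left | right].
  by apply: contrapT => /eqP U1_neqU; apply: no_U1; exists U1.
have [W [W_sub U1W U1W_full]] := subrep_complement U1_sub.
have [U2_sub UE] : subrepresentation phi (U :&: W)%VS /\ (U1 + (U :&: W))%VS = U.
  split; first exact: subrep_cap.
  by rewrite capvC vspace_modl // U1W_full capfv.
have U1U2 : (U1 :&: (U :&: W) = 0)%VS by rewrite (capvC U) capvA U1W cap0v.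
have dimE : \dim U = (\dim U1 + \dim (U :&: W))%N.
  by rewrite -dimv_disjoint_sum // UE.
have dim1 : (\dim U1 < m)%N.
  apply: leq_trans le_Um; rewrite ltn_neqAle dimvS // andbT.
  by apply: contraNneq U1_neqU => dim_eq; rewrite eqEdim U1U dim_eq /=.
have dim2 : (\dim (U :&: W) < m)%N.
  apply: leq_trans le_Um; rewrite dimE -[X in (X < _)%N]add0n ltn_add2r.
  by rewrite lt0n dimv_eq0.
have [s1 [irr1 sum1 dims1]] := IHm _ dim1 U1_sub.
have [s2 [irr2 sum2 dims2]] := IHm _ dim2 U2_sub.
exists (s1 ++ s2); rewrite !big_cat /= sum1 sum2 dims1 dims2 -dimE; split=> // W'.
by rewrite mem_cat => /orP[/irr1 | /irr2].
Qed.

Lemma completely_reducible_of_killing : completely_reducible phi.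
Proof.
have full_sub : subrepresentation phi fullv by move=> x v _; apply: memvf.
have [s [irr sumE dimE]] := subrep_decomposition full_sub.
exists (size s), (fun i => nth 0%VS s i); split=> [i||].
- exact/irr/mem_nth.
- apply/directvP => /=.
  rewrite -(big_mkord xpredT (fun i => \dim (nth 0%VS s i))).
  rewrite -(big_mkord xpredT (fun i => nth 0%VS s i)).
  rewrite -(big_nth 0%VS xpredT id) -(big_nth 0%VS xpredT (fun W => \dim W)).
  by rewrite sumE dimE.
rewrite -(big_mkord xpredT (fun i => nth 0%VS s i)).
by rewrite -(big_nth 0%VS xpredT id) sumE.
Qed.

End Complement.

Theorem theorem3p3 (R : realType) (g : z22Lie R[i]) (t : {vspace g})
    (V : vectType R[i]) (phi : 'Hom(g, 'End(V))) :
  basic g -> simple g -> cartan_subalgebra t -> self_centralizing t ->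
  is_representation phi -> completely_reducible phi.
Proof.
by move=> [K_nondeg _] _ _ _ phiP; apply: completely_reducible_of_killing.
Qed.
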